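(* Let $n\ge 1$ be an integer. Suppose that $k=p_1^{r_1}\cdots p_m^{r_m}$, where $p_1,\dots,p_m$ are distinct primes and $r_i\ge 1$, and that $(\mathbb{Z}/p_i^{r_i}\mathbb{Z})^n$ satisfies property $D$ for each $1\le i\le m$. Then $$\mathfrak{s}\left((\mathbb{Z}/k\mathbb{Z})^n\right)\leq (k-1)\,4^n+k .$$
   Context: For a finite abelian group $G$, $\exp(G)$ denotes its exponent (the maximal order of an element of $G$). The Erd\H{o}s-Ginzburg-Ziv constant $\mathfrak{s}(G)$ is the smallest $N\in\mathbb{N}$ such that any sequence of $N$ elements of $G$ (repetitions allowed) contains a subsequence of length $\exp(G)$ whose sum is $0$. A finite abelian group $G$ satisfies property $D$ if every sequence $S$ of elements of $G$ of length $\mathfrak{s}(G)-1$ that does not contain a subsequence of length $\exp(G)$ summing to $0$, when viewed as a multiset, has the form $S=\bigcup_{i=1}^{\exp(G)-1}T$ (multiset union of $\exp(G)-1$ copies of $T$) for some set $T\subset G$; that is, every element appearing in $S$ appears exactly $\exp(G)-1$ times. *)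

(* Defs.v *)
From HB Require Import structures.
From mathcomp Require Import all_boot all_order all_algebra all_fingroup all_solvable.

Set Implicit Arguments.
Unset Strict Implicit.
Unset Printing Implicit Defensive.

Import GRing.Theory.

(* Finite abelian groups are written additively, as [finZmodType]s; the
   multiplicative notions of fingroup ([exponent], [#[x]]) apply to them through
   the coercion to [finGroupType]. *)

Section ErdosGinzburgZiv.

Variable G : finZmodType.

Definition expG : nat := exponent [set: G].

Lemma expG_max_order : expG = \max_(x : G) #[x]%g.
Proof.
have abG : abelian [set: G] by apply: FinRing.zmod_abelian.
apply/eqP; rewrite eqn_leq; apply/andP; split.
  rewrite /expG; have [x _ ->] := exponent_witness (abelian_nil abG).
  exact: leq_bigmax.
apply/bigmax_leqP => x _; apply: dvdn_leq; first exact: exponent_gt0.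
by apply: dvdn_exponent; rewrite inE.
Qed.

Definition has_zero_sum_subseq (S : seq G) : bool :=
  [exists T : expG.-tuple G, subseq T S && (\sum_(x <- T) x == 0)%R].

Definition egz_bound (N : nat) : bool :=
  [forall S : N.-tuple G, has_zero_sum_subseq S].

Lemma egz_bound_exists : exists N, egz_bound N.
Proof.
exists (#|G| * expG).+1; apply/forallP => S.
have [x Sx] : exists x : G, expG <= count_mem x S.
  apply/existsP; apply: contraT => /existsPn small.
  suff : size S <= #|G| * expG by rewrite size_tuple ltnn.
  have -> : size S = \sum_(x : G) count_mem x S.
    rewrite -sum1_size (partition_big id predT) //=.
    by apply: eq_bigr => x _; rewrite sum1_count.
  rewrite -[leqRHS]sum_nat_const; apply: leq_sum => x _.
  by apply: ltnW; rewrite ltnNge small.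
apply/existsP; exists [tuple of nseq expG x] => /=; apply/andP; split.
  apply: (@subseq_trans _ (filter (pred1 x) S)); last exact: filter_subseq.
  have /all_pred1P -> := filter_all (pred1 x) S.
  rewrite size_filter -(subnKC Sx) nseqD; exact: prefix_subseq.
rewrite big_nseq iter_addr_0 -FinRing.zmodXgE.
by apply/eqP; apply: expg_exponent; rewrite inE.
Qed.

Definition egz : nat := ex_minn egz_bound_exists.

Definition propertyD : Prop :=
  forall S : seq G,
    size S = egz - 1 -> ~~ has_zero_sum_subseq S ->
    exists T : {set G}, perm_eq S (flatten (nseq (expG - 1) (enum T))).

End ErdosGinzburgZiv.

(* (Z/kZ)^n for k >= 1, used as an additive group only.  We take ['I_k.-1.+1]
   rather than ['Z_k] because the latter is Z/2Z when k = 1; the two are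
   convertible for k of the form k'.+2. *)
Definition Zmod_pow (k n : nat) : finZmodType := 'rV['I_k.-1.+1]_n.

(* Main.v *)
Require Import Defs.
From mathcomp Require Import all_boot all_order all_algebra.
From mathcomp Require Import all_fingroup all_solvable zify mpoly.

(* For a prime power q = p^r, property D turns an extremal sequence into q - 1
   copies of a set T such that a sum of q elements of T vanishes only if these
   elements are all equal.  To x in (Z/q)^n attach P_x = prod_c (1 + X_c)^(x_c)
   over F_p.  By Lucas, the coefficient of prod_c X_c^(q-1) in
   P_(x_1) ... P_(x_q) prod_c (1 + X_c)^(q-1) is 1 if x_1 + ... + x_q = 0 and 0
   otherwise.  Let V be the space of v in F_p^T such that sum_a v_a P_a has no
   monomial of degree less than n.  A product of q such combinations has no
   monomial of degree less than q n > (q - 1) n, so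
   sum_a v_1(a) ... v_q(a) = 0 for all v_i in V, which forces dim V <= |T| / 2.
   As V has codimension at most C(2n - 1, n), we get
   |T| <= 2 C(2n - 1, n) = C(2n, n) <= 4^n, hence s <= (q - 1) 4^n + 1.
   The bound (k - 1) 4^n + 1 is then preserved by products of moduli, since
   s(ab) <= (s(b) - 1) a + s(a). *)

Set Implicit Arguments.
Unset Strict Implicit.
Unset Printing Implicit Defensive.

Import GRing.Theory.

Local Open Scope ring_scope.

(** * Linear algebra: subspaces on which a power form vanishes *)

(** For [e = 1] this is the classical bound on totally isotropic subspaces. The form is not linear
    in [w], but [w] is only taken to be a row of a reduced echelon basis, whose pivot entries 0 and
    1 are unchanged by the power [e > 0]. *)
Lemma rank_le_half_of_power_form (F : fieldType) (m s e : nat)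
    (V : 'M[F]_(m, s)) :
  (0 < e)%N ->
  (forall v w : 'rV_s, (v <= V)%MS -> (w <= V)%MS ->
     \sum_a v 0 a * w 0 a ^+ e = 0) ->
  ((\rank V).*2 <= s)%N.
Proof.
move=> e_gt0 V0; set d := \rank V.
(* Choose [d] independent columns of a basis and normalise that minor to the identity. *)
have fullB : row_full (row_base V)^T.
  by rewrite /row_full mxrank_tr; apply: row_base_free.
pose f := fullrankfun fullB.
have injf : injective f by apply: fullrankfun_inj.
pose B1 := colsub f (row_base V).
have uB1 : B1 \in unitmx.
  have -> : B1 = (rowsub f (row_base V)^T)^T.
    by apply/matrixP=> i j; rewrite !mxE.
  by rewrite unitmx_tr fullrowsub_unit.
pose L := invmx B1 *m row_base V.
have Lf i j : L i (f j) = (i == j)%:R.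
  have <- : (1%:M : 'M[F]_d) i j = (i == j)%:R by rewrite mxE.
  by rewrite -(mulVmx uB1) !mxE; apply: eq_bigr => k _; rewrite !mxE.
have LV : (L <= V)%MS by rewrite -(eq_row_base V) submxMl.
(* [L] is the reduced echelon basis of [V] on the coordinates [I]; if
   [d > s - d], some nonzero [c *m L] vanishes off [I], and pairing it with a row
   of [L] isolates a single coordinate of [c]. *)
rewrite leqNgt -addnn; apply/negP => lt_s.
pose I := [set f i | i : 'I_d].
pose M := colsub (fun j : 'I_#|~: I| => enum_val j) L.
have : kermx M != 0.
  rewrite kermx_eq0 -row_leq_rank -ltnNge (leq_ltn_trans (rank_leq_col M)) //.
  by rewrite cardsCs setCK card_ord card_imset // card_ord ltn_subLR
    ?rank_leq_col.
case/rowV0Pn => c /sub_kermxP cM c0.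
have cL a : a \notin I -> (c *m L) 0 a = 0.
  rewrite -in_setC => aI.
  have := congr1 (fun A : 'rV_ _ => A 0 (enum_rank_in aI a)) cM.
  rewrite !mxE => cM0; rewrite -[RHS]cM0; apply: eq_bigr => k _.
  by rewrite !mxE enum_rankK_in.
have cLf j : (c *m L) 0 (f j) = c 0 j.
  rewrite mxE (bigD1 j) //= Lf eqxx mulr1 big1 ?addr0 // => i ij.
  by rewrite Lf (negbTE ij) mulr0.
case/rV0Pn: c0 => i ci.
have := V0 (c *m L) (row i L) (submx_trans (submxMl _ _) LV)
  (submx_trans (row_sub _ _) LV).
rewrite (bigD1 (f i)) //= big1 => [|a ai].
  rewrite cLf [row _ _ _ _]mxE Lf eqxx expr1n mulr1 addr0 => /eqP.
  by rewrite (negbTE ci).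
have [/imsetP[j _ aE]|/cL->] := boolP (a \in I); last by rewrite mul0r.
rewrite aE [row _ _ _ _]mxE Lf; case: eqVneq => [ij|_].
  by rewrite aE ij eqxx in ai.
by rewrite expr0n gtn_eqF ?mulr0.
Qed.

(** * Binomial coefficients modulo p *)

Lemma coef_X1_exp (R : nzRingType) (z j : nat) :
  (('X + 1) ^+ z : {poly R})`_j = 'C(z, j)%:R.
Proof.
rewrite exprD1n coef_sum; under eq_bigr do rewrite coefMn coefXn.
have [jz|zj] := leqP j z.
  rewrite (bigD1 (Ordinal (jz : (j < z.+1)%N))) //= eqxx big1 ?addr0 // => i.
  by rewrite -val_eqE /= eq_sym => /negbTE ->; rewrite mul0rn.
rewrite bin_small // big1 // => i _.
by rewrite gtn_eqF ?mul0rn // (leq_trans (ltn_ord i)).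
Qed.

(** Since (1 + X)^q = 1 + X^q modulo p, the residue of C(z, q - 1) is q-periodic in z; among 0 <= z
    < q only z = q - 1 gives a nonzero value. *)
Lemma bin_prime_power_pred (p r z : nat) : prime p ->
  'C(z, (p ^ r).-1)%:R = (p ^ r %| z.+1)%:R :> 'F_p.
Proof.
move=> p_pr; set q := (p ^ r)%N.
have q_gt0 : (0 < q)%N by rewrite expn_gt0 prime_gt0.
have period y : 'C(q + y, q.-1)%:R = 'C(y, q.-1)%:R :> 'F_p.
  rewrite -!coef_X1_exp exprD exprDn_pchar; last first.
    have pc : p \in [pchar {poly 'F_p}] by rewrite pchar_poly pchar_Fp.
    by rewrite (eq_pnat _ (pcharf_eq pc)) pnatX pnat_id.
  by rewrite expr1n mulrDl mul1r coefD coefXnM prednK // leqnn add0r.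
rewrite (divn_eq z q) -addnS dvdn_addr ?dvdn_mull //.
have : (z %% q < q)%N by rewrite ltn_mod.
elim: (z %/ q)%N (z %% q)%N => [|a IHa] b lt_bq.
  rewrite mul0n add0n; have [lt_b|] := ltnP b q.-1.
    by rewrite bin_small // gtnNdvd //; lia.
  move=> ge_b; have -> : b = q.-1 by lia.
  by rewrite binn prednK ?dvdnn.
by rewrite mulSn -addnA period IHa.
Qed.

(** * Products of powers of 1 + X_c, and vanishing in low degree *)

Section Mpoly.
Variables (n : nat) (R : comNzRingType).
Implicit Types u v : {mpoly R[n]}.

Definition X1_prod (x : 'I_n -> nat) : {mpoly R[n]} :=
  \prod_c ('X_c + 1) ^+ x c.

Lemma mcoeff_X1_prod (x : 'I_n -> nat) (m : 'X_{1..n}) :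
  (X1_prod x)@_m = \prod_c 'C(x c, m c)%:R.
Proof.
(* A common strict bound on all exponents [x c] and [m c], so that every factor expands over the
   same index type and the product distributes. *)
pose K := ((\sum_c x c) + mdeg m).+1.
have xK c : (x c < K)%N.
  by rewrite ltnS (bigD1 c) //= -addnA leq_addr.
have mK c : (m c < K)%N.
  by rewrite ltnS mdegE [X in (_ + X)%N](bigD1 c) //= addnCA leq_addr.
have X1E c : ('X_c + 1) ^+ x c =
    \sum_(j < K) 'X_c ^+ j *+ 'C(x c, j) :> {mpoly R[n]}.
  rewrite exprD1n (big_ord_widen K (fun j => 'X_c ^+ j *+ 'C(x c, j))) //.
  rewrite [RHS](bigID (fun j : 'I_K => (j < (x c).+1)%N)) /=.
  rewrite [X in _ + X]big1 ?addr0 //.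
  by move=> j; rewrite -leqNgt => xj; rewrite bin_small ?mulr0n.
rewrite /X1_prod; under eq_bigr do rewrite X1E.
rewrite bigA_distr_bigA /= raddf_sum /=.
have prodE (f : {ffun 'I_n -> 'I_K}) :
    (\prod_c ('X_c ^+ f c *+ 'C(x c, f c)) : {mpoly R[n]})@_m =
    ([multinom (f c : nat) | c < n] == m)%:R * \prod_c 'C(x c, f c)%:R.
  under eq_bigr do rewrite -mulr_natr.
  rewrite big_split /= -(@mcoeffX n R) [X in _ = X@__ * _]mpolyXE_id.
  have -> : \prod_c (('C(x c, f c)%:R) : {mpoly R[n]}) =
    (\prod_c 'C(x c, f c))%:R by rewrite natr_prod.
  rewrite mulr_natr mcoeffMn -natr_prod mulr_natr.
  by congr (_@_m *+ _); apply: eq_bigr => c _; rewrite mnmE.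
under eq_bigr do rewrite prodE.
rewrite (bigD1 [ffun c => Ordinal (mK c)]) //=.
rewrite [X in _ + X]big1 ?addr0 => [|f fm].
  have -> : [multinom ([ffun c => Ordinal (mK c)] c : nat) | c < n] = m.
    by apply/mnmP => c; rewrite mnmE ffunE.
  by rewrite eqxx mul1r; apply: eq_bigr => c _; rewrite ffunE.
case: eqP => [/mnmP fmE|_]; last by rewrite mul0r.
case/eqP: fm; apply/ffunP => c; apply/val_inj.
by rewrite ffunE /= -fmE mnmE.
Qed.

Definition vanishes_below d u := forall m, (mdeg m < d)%N -> u@_m = 0.

Lemma vanishes_belowM d e u v :
  vanishes_below d u -> vanishes_below e v -> vanishes_below (d + e) (u * v).
Proof.
move=> u0 v0 m md; rewrite mcoeffM big1 // => -[[k1 /= _] [k2 /= _]] /eqP mE.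
have [lt_k1|le_k1] := ltnP (mdeg k1) d; first by rewrite u0 ?mul0r.
rewrite v0 ?mulr0 // -(ltn_add2l d) (leq_ltn_trans _ md) //.
by rewrite mE mdegD leq_add2r.
Qed.

Lemma vanishes_below_prod (q d : nat) (u : 'I_q -> {mpoly R[n]}) :
  (forall i, vanishes_below d (u i)) -> vanishes_below (q * d) (\prod_i u i).
Proof.
elim: q u => [|q IHq] u u0; first by rewrite mul0n => m.
by rewrite big_ord_recl mulSn; apply: vanishes_belowM => //; apply: IHq.
Qed.

End Mpoly.

(** * Counting monomials of low degree *)

Lemma card_bmultinom_le (n b : nat) :
  (#|{: 'X_{1..n < b.+1}}| <= 'C(n + b, n))%N.
Proof.
have mlt (m : 'X_{1..n < b.+1}) c : (m c < b.+1)%N.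
  by apply: leq_ltn_trans (bmdeg m); rewrite mdegE (bigD1 c) //= leq_addr.
pose f (m : 'X_{1..n < b.+1}) := [tuple Ordinal (mlt m c) | c < n].
have injf : injective f.
  move=> m m' E; apply/val_inj/mnmP => c.
  by have := congr1 (fun t => val (tnth t c)) E; rewrite !tnth_mktuple.
rewrite -card_partial_ord_partitions -(card_imset _ injf).
apply/subset_leq_card/subsetP => _ /imsetP[m _ ->]; rewrite inE.
rewrite big_tuple; under eq_bigr do rewrite tnth_mktuple /=.
by rewrite -mdegE -ltnS bmdeg.
Qed.

Lemma bin_le_expn2 (n k : nat) : ('C(n, k) <= 2 ^ n)%N.
Proof.
rewrite -[n in 'C(n, _)]card_ord -card_draws.
have := card_powerset [set: 'I_n]; rewrite cardsT card_ord => <-.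
by apply/subset_leq_card/subsetP => A _; rewrite inE subsetT.
Qed.

Lemma double_card_bmultinom_le (n : nat) : (0 < n)%N ->
  (#|{: 'X_{1..n < n}}|.*2 <= 4 ^ n)%N.
Proof.
case: n => // k _; rewrite -[4%N]/(2 ^ 2)%N -expnM.
apply: leq_trans (bin_le_expn2 (2 * k.+1) k.+1).
have -> : (2 * k.+1 = (k.+1 + k).+1)%N by lia.
(* Pascal and symmetry: C(2k + 2, k + 1) = 2 C(2k + 1, k + 1). *)
rewrite binS -(bin_sub (leq_addl k.+1 k)) addnK addnn leq_double.
exact: card_bmultinom_le.
Qed.

Lemma X1_prodD n (R : comNzRingType) (x y : 'I_n -> nat) :
  X1_prod R x * X1_prod R y = X1_prod R (fun c => x c + y c)%N.
Proof. by rewrite -big_split; apply: eq_bigr => c _; rewrite exprD. Qed.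

Lemma X1_prod_sum n (R : comNzRingType) (I : finType) (x : I -> 'I_n -> nat) :
  \prod_i X1_prod R (x i) = X1_prod R (fun c => \sum_i x i c)%N.
Proof.
rewrite exchange_big; apply: eq_bigr => c _.
by rewrite (big_morph _ (exprD _) (expr0 _)).
Qed.

(** * Families whose only zero sums of length q are constant *)

Section ZeroSumFree.
Variables (p r n s : nat) (x : 'I_s -> 'I_n -> nat).
Local Notation q := (p ^ r)%N.
Hypotheses (p_pr : prime p) (r_gt0 : (0 < r)%N) (n_gt0 : (0 < n)%N).
Hypothesis zero_sum_const : forall f : 'I_q -> 'I_s,
  (forall c, q %| \sum_i x (f i) c)%N -> forall i j, f i = f j.

Let q_gt1 : (1 < q)%N.
Proof. by rewrite -(exp1n r) ltn_exp2r // prime_gt1. Qed.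

(** The shift by q - 1 turns the condition q | z + 1 of [bin_prime_power_pred] into divisibility of
    the sum itself. *)
Lemma zero_sum_coef (f : {ffun 'I_q -> 'I_s}) :
  (X1_prod 'F_p (fun c => \sum_i x (f i) c + q.-1)%N)@_[multinom q.-1 | c < n]
  = [forall c, (q %| \sum_i x (f i) c)%N]%:R.
Proof.
rewrite mcoeff_X1_prod; have q0 := ltnW q_gt1.
transitivity (\prod_c (q %| \sum_i x (f i) c)%N%:R : 'F_p).
  apply: eq_bigr => c _.
  by rewrite mnmE bin_prime_power_pred // -addnS prednK // dvdn_addl.
case: (boolP [forall c, (q %| \sum_i x (f i) c)%N]).
  by move/forallP => q_dvd; rewrite big1 // => c _; rewrite q_dvd.
case/forallPn => c q_ndvd.
by rewrite (bigD1 c) //= (negbTE q_ndvd) mul0r.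
Qed.

(** Every constant [f] sums q copies of one vector, and by [zero_sum_const] no other [f]
    contributes. *)
Lemma sum_zero_sum (g : {ffun 'I_q -> 'I_s} -> 'F_p) :
  \sum_f g f * [forall c, (q %| \sum_i x (f i) c)%N]%:R = \sum_a g [ffun=> a].
Proof.
have i0 : 'I_q := Ordinal (ltnW q_gt1).
rewrite (bigID (mem [set [ffun=> a] | a : 'I_s])) /=.
rewrite [X in _ + X]big1 => [|f nf].
  rewrite addr0 big_imset /= => [|a b _ _ /ffunP/(_ i0)]; last by rewrite !ffunE.
  apply: eq_big => [a|a _]; first by rewrite inE.
  rewrite (_ : [forall c, _]) ?mulr1 //; apply/forallP => c.
  by under eq_bigr do rewrite ffunE; rewrite sum_nat_const card_ord dvdn_mulr.
case: forallP => [/zero_sum_const fc|_]; last by rewrite mulr0.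
by case/imsetP: nf; exists (f i0) => //; apply/ffunP => i; rewrite ffunE.
Qed.

(** Its left kernel is the space V: the combinations of the P_a with no monomial of degree below
    n. *)
Definition low_coefs : 'M['F_p]_(s, #|{: 'X_{1..n < n}}|) :=
  \matrix_(a, m) (X1_prod 'F_p (x a))@_(enum_val m : 'X_{1..n < n}).

Definition X1_comb (v : 'rV['F_p]_s) : {mpoly 'F_p[n]} :=
  \sum_a v 0 a *: X1_prod 'F_p (x a).

Lemma X1_comb_vanishes (v : 'rV_s) :
  (v <= kermx low_coefs)%MS -> vanishes_below n (X1_comb v).
Proof.
move=> /sub_kermxP v0 m mn.
have := congr1 (fun A : 'rV_ _ => A 0 (enum_rank (BMultinom mn))) v0.
rewrite !mxE raddf_sum => v0m; rewrite -[RHS]v0m.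
by apply: eq_bigr => a _; rewrite !mxE enum_rankK /= mcoeffZ.
Qed.

Lemma sum_prod_kernel (v : 'I_q -> 'rV_s) :
  (forall i, v i <= kermx low_coefs)%MS -> \sum_a \prod_i v i 0 a = 0.
Proof.
move=> vK; pose M := [multinom q.-1 | c < n].
have : ((\prod_i X1_comb (v i)) * X1_prod 'F_p (fun=> q.-1))@_M = 0.
  (* [M] has degree (q - 1) n < q n; the last factor only needs the trivial bound 0. *)
  apply: (@vanishes_belowM _ _ (q * n) 0) => //.
    by apply: vanishes_below_prod => i; apply: X1_comb_vanishes.
  rewrite mdegE; under eq_bigr do rewrite mnmE.
  by rewrite sum_nat_const card_ord addn0 mulnC ltn_pmul2r // prednK // ltnW.
(* Compute the same coefficient by expanding over all choices [f] of one term per factor. *)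
rewrite bigA_distr_bigA /= mulr_suml raddf_sum /=.
under eq_bigr => f _ do
  rewrite scaler_prod X1_prod_sum -scalerAl X1_prodD mcoeffZ zero_sum_coef.
rewrite sum_zero_sum => prod0; rewrite -[RHS]prod0.
by apply: eq_bigr => a _; apply: eq_bigr => i _; rewrite ffunE.
Qed.

Lemma zero_sum_free_card : (s <= 4 ^ n)%N.
Proof.
have q_eq : q.-1.+1 = q by rewrite prednK // ltnW.
have form0 (v w : 'rV_s) : (v <= kermx low_coefs)%MS ->
    (w <= kermx low_coefs)%MS -> \sum_a v 0 a * w 0 a ^+ q.-1 = 0.
  (* One slot for [v] and q - 1 slots for [w] specialise the q-linear form to a power form. *)
  move=> vK wK; pose vw (i : 'I_q) := if val i == 0%N then v else w.
  have vw0 : \sum_a \prod_i vw i 0 a = 0.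
    by apply: sum_prod_kernel => i; rewrite /vw; case: ifP.
  rewrite -[RHS]vw0; apply: eq_bigr => a _.
  rewrite -(big_mkord xpredT (fun i => (if i == 0%N then v else w) 0 a)).
  by rewrite -q_eq big_nat_recl //= big_mkord prodr_const card_ord.
(* The kernel has dimension at least s - N, where N is the number of columns; 2 (s - N) <= s gives s
   <= 2 N. *)
have := rank_le_half_of_power_form _ form0; rewrite mxrank_ker -ltnS q_eq.
move=> /(_ q_gt1) le_s; apply: leq_trans (double_card_bmultinom_le n_gt0).
by have := rank_leq_col low_coefs; lia.
Qed.

End ZeroSumFree.

Local Close Scope ring_scope.

(** * Zero sums in (Z/kZ)^n and [egz] in terms of divisibility *)

Lemma val_sum_Zp (k : nat) (I : Type) (S : seq I) (w : I -> nat) :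
  (\sum_(i <- S) inZp (w i) : 'I_k.+1)%R = inZp (\sum_(i <- S) w i).
Proof.
elim: S => [|i S IHS].
  by rewrite !big_nil; apply/val_inj; rewrite /= mod0n.
by rewrite !big_cons IHS; apply/val_inj; rewrite /= modnDm.
Qed.

Lemma inZp_eq0 (k w : nat) : 0 < k -> (inZp w == 0%R :> 'I_k.-1.+1) = (k %| w).
Proof. by case: k => // k _; rewrite -val_eqE. Qed.

Section ZeroSums.
Variables (k n : nat).
Hypotheses (k_gt0 : 0 < k) (n_gt0 : 0 < n).
Local Notation G := (Zmod_pow k n).

Lemma expG_Zmod_pow : expG G = k.
Proof.
rewrite /expG; apply/eqP; rewrite eqn_dvd; apply/andP; split.
  apply/exponentP => x _; rewrite FinRing.zmodXgE.
  apply/rowP => c; rewrite mulmxnE mxE Zp_mulrn.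
  by apply/eqP; rewrite inZp_eq0 // dvdn_mull.
pose x : G := const_mx (inZp 1).
have := expg_exponent (in_setT x).
rewrite FinRing.zmodXgE => /rowP/(_ (Ordinal n_gt0)).
rewrite mulmxnE !mxE Zp_mulrn => /eqP; rewrite inZp_eq0 //.
by move: (exponent _) => e; rewrite /= prednK // /dvdn modnMml mul1n.
Qed.

Definition vec_mod (w : 'I_n -> nat) : G := (\row_c inZp (w c))%R.

Lemma sum_vec_mod_eq0 (I : Type) (S : seq I) (w : I -> 'I_n -> nat) :
  (\sum_(i <- S) vec_mod (w i) == 0)%R = [forall c, k %| \sum_(i <- S) w i c].
Proof.
have E c : ((\sum_(i <- S) vec_mod (w i)) 0 c)%R = inZp (\sum_(i <- S) w i c).
  by rewrite summxE -val_sum_Zp; apply: eq_bigr => i _; rewrite mxE.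
apply/eqP/forallP => [/rowP sum0 c|dvd_sum].
  by move/eqP: (sum0 c); rewrite E mxE inZp_eq0 //.
by apply/rowP => c; rewrite E mxE; apply/eqP; rewrite inZp_eq0 //.
Qed.

Lemma vec_modK (x : G) : vec_mod (fun c => x 0%R c) = x.
Proof. by apply/rowP => c; rewrite mxE valZpK. Qed.

Lemma sum_Zmod_pow_eq0 (I : Type) (S : seq I) (x : I -> G) :
  (\sum_(i <- S) x i == 0)%R = [forall c, k %| \sum_(i <- S) x i 0%R c].
Proof.
by rewrite -sum_vec_mod_eq0; under [in RHS]eq_bigr do rewrite vec_modK.
Qed.

Lemma has_zero_sum_subseqP (S : seq G) :
  reflect (exists T, [/\ subseq T S, size T = k & (\sum_(x <- T) x)%R = 0%R])
          (has_zero_sum_subseq S).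
Proof.
apply: (iffP existsP) => [[T /andP[TS /eqP T0]]|[T [TS szT T0]]].
  by exists T; split=> //; rewrite size_tuple expG_Zmod_pow.
have szT' : size T == expG G by rewrite expG_Zmod_pow szT.
by exists (Tuple szT'); rewrite TS T0 eqxx.
Qed.

End ZeroSums.

(* The index type is arbitrary so that the bound also applies to a sequence of
   sequences, each weighted by its sum. *)
Definition zero_sum_bound (k n N : nat) : Prop :=
  forall (I : eqType) (S : seq I) (w : I -> 'I_n -> nat), N <= size S ->
  exists T, [/\ subseq T S, size T = k & forall c, k %| \sum_(i <- T) w i c].

Lemma zero_sum_bound_leq k n M N :
  M <= N -> zero_sum_bound k n M -> zero_sum_bound k n N.
Proof. by move=> MN HM I S w NS; apply: HM; apply: leq_trans NS. Qed.

Lemma zero_sum_bound_egz k n : 0 < k -> 0 < n ->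
  zero_sum_bound k n (egz (Zmod_pow k n)).
Proof.
move=> k_gt0 n_gt0 I S w; rewrite /egz; case: ex_minnP => N /forallP HN _ NS.
(* [egz] speaks of sequences of one exact length, hence the truncation of [S]. *)
have szS : size (map (fun i => vec_mod k (w i)) (take N S)) == N.
  by rewrite size_map size_takel.
have /has_zero_sum_subseqP[//|//|T [/subseqP[m szm ->]]] := HN (Tuple szS).
rewrite -map_mask size_map => szT /eqP; rewrite big_map sum_vec_mod_eq0 //.
move=> /forallP sum0; exists (mask m (take N S)); split=> //.
exact: subseq_trans (mask_subseq _ _) (take_subseq _ _).
Qed.

Lemma egz_leq k n N : 0 < k -> 0 < n ->
  zero_sum_bound k n N -> egz (Zmod_pow k n) <= N.
Proof.
move=> k_gt0 n_gt0 HN; rewrite /egz; case: ex_minnP => m _; apply.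
apply/forallP => S; apply/has_zero_sum_subseqP => //.
have [|T [TS szT sum0]] := HN _ S (fun x c => x 0%R c).
  by rewrite size_tuple.
by exists T; split=> //; apply/eqP; rewrite sum_Zmod_pow_eq0 //; apply/forallP.
Qed.

(** * Bounds for products of moduli *)

(** Greedy extraction: the last block is removed when at least A terms remain, so (j - 1) a + A
    terms suffice. Adding [a] on the right avoids truncated subtraction at [j = 0]. *)
Lemma disjoint_zero_sums a n A j : zero_sum_bound a n A ->
  forall (I : eqType) (S : seq I) (w : I -> 'I_n -> nat),
  j * a + A <= size S + a ->
  exists2 Ts : seq (seq I), size Ts = j /\ exists R, perm_eq S (flatten Ts ++ R)
  & forall U, U \in Ts -> size U = a /\ forall c, a %| \sum_(i <- U) w i c.
Proof.
move=> HA I S w; elim: j S => [|j IHj] S le_S.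
  by exists [::] => //; split=> //; exists S; rewrite perm_refl.
have [|T [TS szT T0]] := HA I S w; first by rewrite mulSn in le_S; lia.
have [R permR] := perm_to_subseq TS.
have [|Ts [szTs [R' permR']] Ts0] := IHj R.
  by move: le_S; rewrite (perm_size permR) size_cat szT mulSn; lia.
exists (T :: Ts) => [|U]; last by rewrite inE => /predU1P[->|/Ts0].
split; first by rewrite /= szTs.
by exists R'; rewrite (seq.permPl permR) /= -catA perm_cat2l.
Qed.

(** Extract B disjoint blocks of a terms with sums divisible by a, divide these sums by a, and apply
    the bound for b to the sequence of blocks: b of them together have a sum divisible by a b. *)
Lemma zero_sum_boundM a b n A B : 0 < a -> 0 < B ->
  zero_sum_bound a n A -> zero_sum_bound b n B ->
  zero_sum_bound (a * b) n (B.-1 * a + A).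
Proof.
move=> a_gt0 B_gt0 HA HB I S w le_S.
have [|Ts [szTs [R permS]] Ts0] := @disjoint_zero_sums a n A B HA I S w.
  by move: le_S; rewrite -{2}(prednK B_gt0) mulSn; lia.
pose w' (U : seq I) c := (\sum_(i <- U) w i c) %/ a.
have [|Us [UsTs szUs Us0]] := HB _ Ts w'; first by rewrite szTs.
have [Vs permTs] := perm_to_subseq UsTs.
(* The blocks need not follow the order of [S], so their concatenation is a subsequence only up to
   permutation; comparing multiplicities suffices. *)
have /count_subseqP[T TS permT] :
    forall x, count_mem x (flatten Us) <= count_mem x S.
  move=> x; rewrite (seq.permP permS).
  rewrite (seq.permP (perm_cat (perm_flatten permTs) (perm_refl R))).
  by rewrite flatten_cat !count_cat -addnA leq_addr.
have UsP U : U \in Us -> size U = a /\ forall c, a %| \sum_(i <- U) w i c.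
  by move/(mem_subseq UsTs)/Ts0.
exists T; split=> // [|c].
  rewrite -(perm_size permT) size_flatten sumnE big_map -szUs mulnC.
  rewrite -sum1_size big_distrl /= !big_seq.
  by apply: eq_bigr => U /UsP[-> _]; rewrite mul1n.
rewrite -(perm_big _ permT) big_flatten /=.
have -> : \sum_(U <- Us) \sum_(i <- U) w i c = a * \sum_(U <- Us) w' U c.
  rewrite big_distrr /= !big_seq; apply: eq_bigr => U /UsP[_ /(_ c)].
  by rewrite mulnC => /divnK.
by rewrite dvdn_pmul2l.
Qed.

Lemma zero_sum_bound1 n : zero_sum_bound 1 n 1.
Proof.
move=> I [//|i S] w _; exists [:: i]; split=> //.
by rewrite sub1seq mem_head.
Qed.

(** * Prime powers, and the general modulus *)

Lemma egz_prime_power_leq (p r n : nat) : prime p -> 0 < r -> 0 < n ->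
  propertyD (Zmod_pow (p ^ r) n) ->
  egz (Zmod_pow (p ^ r) n) <= ((p ^ r).-1 * 4 ^ n).+1.
Proof.
move=> p_pr r_gt0 n_gt0 D; set q := p ^ r; set G := Zmod_pow q n.
have q_gt0 : 0 < q by rewrite expn_gt0 prime_gt0.
case e_eq: (egz G) => [|e] //; rewrite ltnS.
(* By minimality of [egz], some sequence of length [egz - 1] is free of zero sums. *)
have [S S0] : exists S : e.-tuple G, ~~ has_zero_sum_subseq S.
  apply/existsP; rewrite -negb_forall; apply/negP => He.
  move: e_eq; rewrite /egz; case: ex_minnP => m _ /(_ e He) /[swap] ->.
  by rewrite ltnn.
have [|T] := D S _ S0; first by rewrite size_tuple e_eq subn1.
rewrite expG_Zmod_pow // subn1 => permS.
have countS x : count_mem x S = q.-1 * (x \in T).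
  rewrite (seq.permP permS) count_flatten map_nseq sumn_nseq mulnC.
  by rewrite count_uniq_mem ?enum_uniq // mem_enum.
have -> : e = q.-1 * #|T|.
  rewrite -(size_tuple S) (perm_size permS) size_flatten /shape map_nseq.
  by rewrite sumn_nseq mulnC cardE.
rewrite leq_mul2l; apply/orP; right.
pose x (a : 'I_#|T|) (c : 'I_n) : nat := (enum_val a : G) 0%R c.
apply: (@zero_sum_free_card p r n #|T| x) => // f f0 i j.
apply/eqP; apply: contraNT S0 => fij; apply/has_zero_sum_subseqP => //.
pose y i : G := enum_val (f i).
(* A nonconstant family of q elements of [T] takes no value q times, so it fits into the q - 1
   copies of [T] that make up [S]. *)
have /count_subseqP[U US permU] :
    forall z, count_mem z (map y (enum 'I_q)) <= count_mem z S.
  move=> z; rewrite countS; have [zT|zT] := boolP (z \in T).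
    rewrite muln1 -ltnS prednK // -[X in _ < X]card_ord cardE -(size_map y).
    rewrite ltn_neqAle count_size andbT -all_count; apply/allPn.
    have [yi|yi] := eqVneq (y i) z.
      exists (y j); first by rewrite map_f // mem_enum.
      by rewrite /= -yi; apply: contra fij => /eqP/enum_val_inj->.
    by exists (y i); first by rewrite map_f // mem_enum.
  rewrite muln0 leqn0 -leqn0 leqNgt -has_count; apply/hasPn => _ /mapP[l _ ->].
  by apply: contra zT => /eqP <-; apply: enum_valP.
exists U; split=> //.
  by rewrite -(perm_size permU) size_map -cardE card_ord.
rewrite -(perm_big _ permU) big_map; apply/eqP; rewrite sum_Zmod_pow_eq0 //.
by apply/forallP => c; rewrite big_enum; apply: f0.
Qed.

Theorem theorem4 (n m : nat) (p r : 'I_m -> nat) (k : nat) :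
  1 <= n ->
  injective p ->
  (forall i, prime (p i)) ->
  (forall i, 1 <= r i) ->
  k = \prod_(i < m) p i ^ r i ->
  (forall i, propertyD (Zmod_pow (p i ^ r i) n)) ->
  egz (Zmod_pow k n) <= (k - 1) * 4 ^ n + k.
Proof.
move=> n_gt0 _ p_pr r_gt0 -> D; set P := \prod_(i < m) _.
have [P_gt0 HP] : 0 < P /\ zero_sum_bound P n (P.-1 * 4 ^ n).+1.
  apply: (big_ind (fun l => 0 < l /\ zero_sum_bound l n (l.-1 * 4 ^ n).+1)).
  - by split=> //; apply: zero_sum_bound1.
  - move=> a b [a_gt0 Ha] [b_gt0 Hb]; split; first by rewrite muln_gt0 a_gt0.
    (* The form of the bound is preserved exactly: (b - 1) 4^n a + (a - 1) 4^n + 1 = (a b - 1) 4^n +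
       1. *)
    have := zero_sum_boundM a_gt0 (ltn0Sn _) Ha Hb; apply: zero_sum_bound_leq.
    by rewrite /= -(prednK a_gt0) -(prednK b_gt0) /=; nia.
  - move=> i _; have q_gt0 : 0 < p i ^ r i by rewrite expn_gt0 prime_gt0.
    split=> //; apply: zero_sum_bound_leq (zero_sum_bound_egz q_gt0 n_gt0).
    exact: egz_prime_power_leq.
by apply: leq_trans (egz_leq P_gt0 n_gt0 HP) _; rewrite subn1 -addn1 leq_add2l.
Qed.
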